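(* On HDAs over $\Sigma$, ${\underline{\leftrightarrow}_{qhp}}\subsetneq{\underline{\leftrightarrow}_{shp}}$. In fact, even ${\underline{\leftrightarrow}_{qhp}}\not\supseteq{\underline{\leftrightarrow}_{\{\sqsubseteq,\sqsupseteq,\hookleftarrow\}}}$, i.e. there are HDAs that are $\{\sqsubseteq,\sqsupseteq,\hookleftarrow\}$-bisimilar but not qhp-bisimilar.
   Context: HDAs. $\Sigma$ is a fixed set of actions, containing pairwise distinct actions $a,b,c,d$. A conclist is $U=(n,\lambda)$ with $n\in\mathbb N$ and $\lambda:\{1<\dots<n\}\to\Sigma$. The category $\square$ has conclists as objects; a morphism $(m,\lambda)\to(n,\mu)$ is a pair $(f,\varepsilon)$ with $f:\{1,\dots,m\}\to\{1,\dots,n\}$ injective, order- and label-preserving, and $\varepsilon:\{1,\dots,n\}\to\{0,*,1\}$ with $\varepsilon^{-1}( * )=\mathrm{im} f$; composition is $(g,\zeta)\circ(f,\varepsilon)=(g\circ f,\eta)$ with $\eta(g(t))=\varepsilon(t)$ and $\eta(u)=\zeta(u)$ for $u\notin\mathrm{im}\,g$. For $1\le i\le n$, $k\in\{0,1\}$, the coface map $d_i^k:U\to V$ ($V$ of dimension $n$, $U$ of dimension $n-1$) has $f$ omitting position $i$, $\varepsilon(i)=k$, and $\varepsilon(j)=*$ for $j\ne i$. A precubical set is a functor $X:\square^{op}\to\mathbf{Set}$; elements of $X[U]$, $U=(n,\lambda)$, are $n$-dimensional cells, and $\delta_i^k:=X[d_i^k]$. An HDA is a pair $(X,i)$ of a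 precubical set and an initial $0$-dimensional cell $i$. Paths. A path of an HDA $\mathcal X$ is a sequence $\alpha=(x_0,\varphi_1,x_1,\dots,\varphi_n,x_n)$ ($n\ge 0$) with $x_0$ the initial cell, $x_j\in X[U_j]$, where for each $j$ either $\varphi_j=d^0_{i_j}:U_{j-1}\to U_j$ with $x_{j-1}=\delta^0_{i_j}(x_j)$ (up-step, starting an event) or $\varphi_j=d^1_{i_j}:U_j\to U_{j-1}$ with $x_j=\delta^1_{i_j}(x_{j-1})$ (down-step, ending an event). $\alpha\hookrightarrow\alpha'$ means $\alpha$ is a prefix of $\alpha'$. $\alpha\leftrightarrows^\ell\beta$ ($\ell$-similarity): one of $\alpha,\beta$ is obtained from the other by replacing, around the cell $x_\ell$, $(d_i^0,x_\ell,d_j^0)$ by $(d_{j-1}^0,x'_\ell,d_i^0)$, or $(d_j^1,x_\ell,d_i^1)$ by $(d_i^1,x'_\ell,d_{j-1}^1)$, for some $i<j$ and some cell $x'_\ell$. $\alpha\sqsubseteq^\ell\beta$ ($\beta$ subsumes $\alpha$ at $\ell$): $\alpha$ is obtained from $\beta$ by replacing, around $x_\ell$, $(d_i^0,x_\ell,d_j^1)$ by $(d_{j-1}^1,x'_\ell,d_i^0)$, or $(d_j^0,x_\ell,d_i^1)$ by $(d_i^1,x'_\ell,d_{j-1}^0)$, for some $i<j$. ST-traces. Given a down-step at position $p$ of a path, move it to the left: as long as the step directly before it is a down-step, or an up-step whose index differs from the current index of the moving down-step, there is a unique replacement moving it one position left: for some $i<j$ and cells $x,x'$, it replaces $(d_j^1,x,d_i^1)$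 by $(d_i^1,x',d_{j-1}^1)$ or conversely (if the step directly before is a down-step), or it replaces $(d_i^0,x,d_j^1)$ by $(d_{j-1}^1,x',d_i^0)$ or $(d_j^0,x,d_i^1)$ by $(d_i^1,x',d_{j-1}^0)$ (if the step directly before is an up-step). This stops when the step directly before it, at position $k$, is an up-step with the same index; put $\mathrm{start}(p)=k$. $\mathsf{ST}(\alpha)$ is the sequence whose $j$-th entry is $a^+$ if $\varphi_j$ is an up-step starting an event labelled $a$ (the label of the $i_j$-th event of $U_j$), and $a^{\mathrm{start}(j)}$ if $\varphi_j$ is a down-step ending an event labelled $a$ (the label of the $i_j$-th event of $U_{j-1}$). $I$-bisimulations. For $I\subseteq\{\sqsubseteq,\sqsupseteq,\leftrightarrows,\hookleftarrow\}$, an $I$-bisimulation between HDAs $\mathcal Y,\mathcal Z$ is a relation $\mathfrak R$ between paths of $\mathcal Y$ and of $\mathcal Z$ satisfying the following clauses, each also with the roles of $\mathcal Y$ and $\mathcal Z$ exchanged: (1) the length-$0$ paths of $\mathcal Y$ and $\mathcal Z$ are related; (2) if $(\alpha,\beta)\in\mathfrak R$ then $\mathsf{ST}(\alpha)=\mathsf{ST}(\beta)$; (3) if $(\alpha,\beta)\in\mathfrak R$ and $\alpha\hookrightarrow\alpha'$, there is $\beta'$ with $\beta\hookrightarrow\beta'$ and $(\alpha',\beta')\in\mathfrak R$; and those of the following whose symbol lies in $I$: ($\sqsubseteq$) if $(\alpha,\beta)\in\mathfrak R$ and $\alpha\sqsubseteq^\ell\alpha'$, there is $\beta'$ with $\beta\sqsubseteq^\ell\beta'$,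 $(\alpha',\beta')\in\mathfrak R$; ($\sqsupseteq$) the same with $\alpha'\sqsubseteq^\ell\alpha$ and $\beta'\sqsubseteq^\ell\beta$; ($\leftrightarrows$) the same with $\alpha'\leftrightarrows^\ell\alpha$ and $\beta'\leftrightarrows^\ell\beta$; ($\hookleftarrow$) the same with $\alpha'\hookrightarrow\alpha$ and $\beta'\hookrightarrow\beta$. $\mathcal Y,\mathcal Z$ are $I$-bisimilar, $\mathcal Y\,\underline{\leftrightarrow}_I\,\mathcal Z$, if an $I$-bisimulation between them exists. Names: shp is $I=\{\sqsubseteq\}$; qhp is $I=\{\sqsubseteq,\leftrightarrows\}$. *)

(* Defs.v *)
From Stdlib Require Import ProofIrrelevance.
From mathcomp Require Import all_boot zify.

Set Implicit Arguments.
Unset Strict Implicit.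
Unset Printing Implicit Defensive.

(* Positions are numbered from 0 (elements of 'I_n) instead of from 1; only    *)
(* their order and the operations j - 1, j + 1 matter below.                   *)

Section Box.
Variable Sigma : Type.

Record conclist := Conclist { dim : nat; lab : {ffun 'I_dim -> Sigma} }.

(* The signs 0, 1, * are encoded as Some false, Some true, None.               *)
Definition is_box_mor (U V : conclist)
    (f : {ffun 'I_(dim U) -> 'I_(dim V)})
    (e : {ffun 'I_(dim V) -> option bool}) : Prop :=
  [/\ injective f,
      {homo f : s t / s <= t},
      forall t, lab V (f t) = lab U t
    & forall u, e u = None <-> exists t, f t = u].

Record box_mor (U V : conclist) := BoxMor {
  bfun : {ffun 'I_(dim U) -> 'I_(dim V)};
  bsgn : {ffun 'I_(dim V) -> option bool};
  box_morP : is_box_mor bfun bsgn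
}.

Lemma box_mor_eq U V (p q : box_mor U V) :
  bfun p =1 bfun q -> bsgn p =1 bsgn q -> p = q.
Proof.
case: p q => [f e p] [g z q] /= /ffunP fg /ffunP ez.
by subst g z; rewrite (proof_irrelevance _ p q).
Qed.

Fact box_id_subproof U :
  @is_box_mor U U [ffun t => t] [ffun => None].
Proof.
split=> [s t|s t|t|u]; rewrite ?ffunE //.
by split=> // _; exists u; rewrite ffunE.
Qed.
Definition box_id U : box_mor U U := BoxMor (box_id_subproof U).

Section Comp.
Variables (U V W : conclist) (g : box_mor V W) (f : box_mor U V).

Definition comp_fun : {ffun 'I_(dim U) -> 'I_(dim W)} :=
  [ffun t => bfun g (bfun f t)].
Definition comp_sgn : {ffun 'I_(dim W) -> option bool} :=
  [ffun u => if [pick t | bfun g t == u] is Some t then bsgn f t else bsgn g u].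

Fact box_comp_subproof : is_box_mor comp_fun comp_sgn.
Proof.
have [gI gM gL gS] := box_morP g; have [fI fM fL fS] := box_morP f.
split=> [s t|s t st|t|u]; rewrite ?ffunE.
- by move/gI/fI.
- exact/gM/fM.
- by rewrite gL.
case: pickP => [t /eqP <-|nog].
  split=> [/fS[s <-]|[s]]; first by exists s; rewrite ffunE.
  by rewrite ffunE => /gI E; apply/fS; exists s.
split=> [/gS[t tu]|[s su]]; first by have := nog t; rewrite tu eqxx.
by have := nog (bfun f s); rewrite -su ffunE eqxx.
Qed.
Definition box_comp : box_mor U W := BoxMor box_comp_subproof.
End Comp.

Lemma comp_sgn_in U V W (g : box_mor V W) (f : box_mor U V) t :
  bsgn (box_comp g f) (bfun g t) = bsgn f t.
Proof.
have [gI _ _ _] := box_morP g.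
rewrite ffunE; case: pickP => [s /eqP/gI->//|/(_ t)].
by rewrite eqxx.
Qed.

Lemma comp_sgn_out U V W (g : box_mor V W) (f : box_mor U V) u :
  (forall t, bfun g t <> u) -> bsgn (box_comp g f) u = bsgn g u.
Proof. by move=> nog; rewrite ffunE; case: pickP => // t /eqP/nog. Qed.

Lemma box_compA U V W T (h : box_mor W T) (g : box_mor V W) (f : box_mor U V) :
  box_comp h (box_comp g f) = box_comp (box_comp h g) f.
Proof.
apply: box_mor_eq => [t|u]; first by rewrite !ffunE.
have [hI _ _ _] := box_morP h.
have [/existsP[w /eqP<-]|/existsPn noh] := boolP [exists w, bfun h w == u].
  rewrite comp_sgn_in.
  have [/existsP[v /eqP<-]|/existsPn nog] := boolP [exists v, bfun g v == w].
    rewrite comp_sgn_in.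
    have <- : bfun (box_comp h g) v = bfun h (bfun g v) by rewrite ffunE.
    by rewrite comp_sgn_in.
  rewrite comp_sgn_out => [|v]; last by apply/eqP; apply: nog.
  rewrite comp_sgn_out ?comp_sgn_in // => v.
  by rewrite ffunE => /hI; apply/eqP; apply: nog.
by rewrite !comp_sgn_out // => v; rewrite ?ffunE; apply/eqP; apply: noh.
Qed.

Lemma box_comp1f U V (f : box_mor U V) : box_comp (box_id V) f = f.
Proof.
apply: box_mor_eq => [t|u]; first by rewrite !ffunE.
have {1}-> : u = bfun (box_id V) u by rewrite ffunE.
exact: comp_sgn_in.
Qed.

Lemma box_compf1 U V (f : box_mor U V) : box_comp f (box_id U) = f.
Proof.
apply: box_mor_eq => [t|u]; first by rewrite !ffunE.
have [_ _ _ fS] := box_morP f.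
have [/existsP[w /eqP<-]|/existsPn nof] := boolP [exists w, bfun f w == u].
  by rewrite comp_sgn_in ffunE; apply/esym/fS; exists w.
by rewrite comp_sgn_out // => v; apply/eqP; apply: nof.
Qed.

Definition del (V : conclist) (i : 'I_(dim V)) : conclist :=
  Conclist [ffun t : 'I_(dim V).-1 => lab V (lift i t)].

Fact coface_subproof (V : conclist) (i : 'I_(dim V)) (k : bool) :
  @is_box_mor (del i) V
    [ffun t => lift i t] [ffun j => if j == i then Some k else None].
Proof.
split=> [s t|s t st|t|u]; rewrite ?ffunE.
- exact: lift_inj.
- by rewrite leq_bump2.
- by [].
case: (unliftP i u) => [t ->|->].
  by rewrite eq_sym (negbTE (neq_lift i t)); split=> // _; exists t; rewrite ffunE.
rewrite eqxx; split=> // -[t]; rewrite ffunE => /eqP.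
by rewrite eq_sym (negbTE (neq_lift i t)).
Qed.
Definition coface (V : conclist) (i : 'I_(dim V)) (k : bool) :
  box_mor (del i) V := BoxMor (coface_subproof i k).

Record precubical := Precubical {
  pcell :> conclist -> Type;
  pmap : forall U V, box_mor U V -> pcell V -> pcell U;
  pmap_id : forall U (x : pcell U), pmap (box_id U) x = x;
  pmap_comp : forall U V W (g : box_mor V W) (f : box_mor U V) (x : pcell W),
    pmap (box_comp g f) x = pmap f (pmap g x)
}.

Definition cell (X : precubical) : Type := {U : conclist & X U}.

Definition cdim (X : precubical) (x : cell X) : nat := dim (tag x).

Definition delta (X : precubical) (x : cell X) (i : 'I_(cdim x)) (k : bool) :
  cell X := Tagged X (pmap (coface i k) (tagged x)).

Lemma pmap_eq (X : precubical) V (w : X V) n (l1 l2 : {ffun 'I_n -> Sigma})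
    (p : box_mor (Conclist l1) V) (q : box_mor (Conclist l2) V) :
  bfun p =1 bfun q -> bsgn p =1 bsgn q ->
  Tagged X (pmap p w) = Tagged X (pmap q w).
Proof.
move=> pq e; have E : l1 = l2.
  apply/ffunP => t; have [_ _ pL _] := box_morP p; have [_ _ qL _] := box_morP q.
  by rewrite -[l1 t]pL -[l2 t]qL pq.
by subst l2; rewrite (box_mor_eq pq e).
Qed.

(* For i < j, d_j^l o d_i^k = d_i^k o d_{j-1}^l up to equality of sources.     *)
Lemma delta_comm (X : precubical) (w : cell X) (k l : bool)
    (i j : 'I_(cdim w)) (i' : 'I_(cdim (delta j l))) (j' : 'I_(cdim (delta i k))) :
  i < j -> i' = i :> nat -> j' = j.-1 :> nat ->
  delta i' k = delta j' l.
Proof.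
case: w i j i' j' => V w; rewrite /delta /cdim /= => i j i' j' ij ii' jj'.
have lij : lift i j' = j by apply: val_inj; rewrite /= /bump jj'; lia.
have lji : lift j i' = i by apply: val_inj; rewrite /= /bump ii'; lia.
rewrite -!pmap_comp; apply: pmap_eq => [t|u].
  rewrite !ffunE; apply: val_inj; rewrite /= ii' jj' /bump.
  by lia.
have [->|uj] := eqVneq u j.
  rewrite comp_sgn_out => [|t]; last first.
    by rewrite ffunE => /eqP; rewrite eq_sym (negbTE (neq_lift _ _)).
  have := comp_sgn_in (coface i k) (@coface (del i) j' l) j'.
  by rewrite {1}[bfun _ _]ffunE lij => ->; rewrite !ffunE !eqxx.
have [->|ui] := eqVneq u i.
  rewrite [RHS]comp_sgn_out => [|t]; last first.
    by rewrite ffunE => /eqP; rewrite eq_sym (negbTE (neq_lift _ _)).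
  have := comp_sgn_in (coface j l) (@coface (del j) i' k) i'.
  by rewrite {1}[bfun _ _]ffunE lji => ->; rewrite !ffunE !eqxx.
have [s us|] := unliftP j u; last by move/eqP; rewrite (negbTE uj).
have [t ut|] := unliftP i u; last by move/eqP; rewrite (negbTE ui).
have := comp_sgn_in (coface j l) (@coface (del j) i' k) s.
rewrite {1}[bfun _ _]ffunE -us => ->.
have := comp_sgn_in (coface i k) (@coface (del i) j' l) t.
rewrite {1}[bfun _ _]ffunE -ut => ->.
rewrite !ffunE; case: eqP => [E|_].
  by rewrite us E lji eqxx in ui.
by case: eqP => // E; rewrite ut E lij eqxx in uj.
Qed.

Record HDA := MkHDA {
  carrier :> precubical;
  init : cell carrier;
  init_dim : cdim init = 0
}.

(* Up i (resp. Dn i) stands for an up-step d_i^0 (resp. a down-step d_i^1).    *)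
Inductive step := Up of nat | Dn of nat.

Definition is_face (X : precubical) (k : bool) (i : nat) (x y : cell X) : Prop :=
  exists2 i0 : 'I_(cdim x), i0 = i :> nat & y = delta i0 k.

Definition is_step (X : precubical) (x : cell X) (phi : step) (y : cell X) :=
  match phi with
  | Up i => is_face false i y x
  | Dn i => is_face true i x y
  end.

Fixpoint is_hpath (X : precubical) (x : cell X) (s : seq (step * cell X)) : Prop :=
  match s with
  | [::] => True
  | (phi, y) :: s' => is_step x phi y /\ is_hpath y s'
  end.

Lemma face_swap (X : precubical) (k l : bool) i j (w x y : cell X) :
  i < j -> is_face l j w x -> is_face k i x y ->
  exists2 x', is_face k i w x' & is_face l j.-1 x' y.
Proof.
move=> ij [j0 jE ->] [i0 iE ->]; have jlt := ltn_ord j0.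
have hi : i < cdim w by lia.
have hj : j.-1 < cdim (delta (Ordinal hi) k) by rewrite /cdim /= -/(cdim w); lia.
exists (delta (Ordinal hi) k); first by exists (Ordinal hi).
exists (Ordinal hj) => //; apply: delta_comm => //=; lia.
Qed.

Lemma face_swapV (X : precubical) (k l : bool) i j (w x y : cell X) :
  i < j -> is_face k i w x -> is_face l j.-1 x y ->
  exists2 x', is_face l j w x' & is_face k i x' y.
Proof.
move=> ij [i0 iE ->] [j0 jE ->]; have jlt := ltn_ord j0.
rewrite {2}/cdim /= -/(cdim w) in jlt.
have hj : j < cdim w by lia.
have hi : i < cdim (delta (Ordinal hj) l) by rewrite /cdim /= -/(cdim w); lia.
exists (delta (Ordinal hj) l); first by exists (Ordinal hj).
exists (Ordinal hi) => //; apply/esym/delta_comm => //=; lia.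
Qed.

Lemma face_diamond (X : precubical) (k l : bool) i j (w x y : cell X) :
  i < j -> is_face l j w x -> is_face k i w y ->
  exists2 z, is_face k i x z & is_face l j.-1 y z.
Proof.
move=> ij [j0 jE ->] [i0 iE ->]; have jlt := ltn_ord j0.
have hi : i < cdim (delta j0 l) by rewrite /cdim /= -/(cdim w); lia.
have hj : j.-1 < cdim (delta i0 k) by rewrite /cdim /= -/(cdim w); lia.
exists (delta (Ordinal hi) k); first by exists (Ordinal hi).
exists (Ordinal hj) => //; apply: delta_comm => //=; lia.
Qed.

Lemma is_hpath_cat (X : precubical) (x : cell X) s t :
  is_hpath x (s ++ t) <-> is_hpath x s /\ is_hpath (last x (unzip2 s)) t.
Proof.
elim: s x => [|[phi y] s IH] x /=; first by tauto.
by rewrite IH; tauto.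
Qed.

(* The path (x_0, phi_1, x_1, ..., phi_n, x_n) is the sequence of the pairs    *)
(* (phi_j, x_j), 1 <= j <= n; x_0 is the initial cell and is left implicit.    *)
Record hpath (X : HDA) := HPath {
  psteps : seq (step * cell X);
  hpathP : is_hpath (init X) psteps
}.

Definition hpath0 (X : HDA) : hpath X := @HPath X [::] I.

Section Relations.
Variable X : HDA.
Implicit Types (alpha beta : hpath X) (l p k : nat) (f g : step).

Definition hprefix alpha beta : Prop :=
  exists t, psteps beta = psteps alpha ++ t.

(* beta is obtained from alpha by replacing (f, x_l, g) by (f', x'_l, g').     *)
Definition replaced l f g f' g' alpha beta : Prop :=
  exists s x x' y t,
  [/\ (size s).+1 = l,
      psteps alpha = s ++ [:: (f, x), (g, y) & t]
    & psteps beta = s ++ [:: (f', x'), (g', y) & t]].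

Definition swapped l alpha beta : Prop :=
  exists i j, i < j /\
    (replaced l (Up i) (Up j) (Up j.-1) (Up i) alpha beta \/
     replaced l (Dn j) (Dn i) (Dn i) (Dn j.-1) alpha beta).

Definition similar l alpha beta : Prop :=
  swapped l alpha beta \/ swapped l beta alpha.

(* beta subsumes alpha at l.                                                   *)
Definition subsumed l alpha beta : Prop :=
  exists i j, i < j /\
    (replaced l (Up i) (Dn j) (Dn j.-1) (Up i) beta alpha \/
     replaced l (Up j) (Dn i) (Dn i) (Up j.-1) beta alpha).

End Relations.

(* Position of the up-step reached by moving leftwards a down-step of current  *)
(* index i, the steps before it being r in reverse order (nearest first); the  *)
(* replacements only depend on the indices. See start_ofP.                     *)
Fixpoint start_pos (i : nat) (r : seq step) : nat :=
  match r with
  | [::] => 0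
  | Dn j :: r' => start_pos (if i < j then i else i.+1) r'
  | Up j :: r' =>
      if j == i then size r else start_pos (if j < i then i.-1 else i) r'
  end.

(* The label of the i-th event of x; None only if i is out of range, which     *)
(* does not occur along a path.                                                *)
Definition label (X : precubical) (x : cell X) (i : nat) : option Sigma :=
  omap (lab (tag x)) (insub i).

Inductive st_entry := Started of option Sigma | Ended of option Sigma & nat.

(* r is the sequence of the steps already read, in reverse order.              *)
Fixpoint st_from (X : precubical) (r : seq step) (x : cell X)
    (s : seq (step * cell X)) : seq st_entry :=
  match s with
  | [::] => [::]
  | (phi, y) :: s' =>
      match phi with
      | Up i => Started (label y i)
      | Dn i => Ended (label x i) (start_pos i r)
      end :: st_from (phi :: r) y s'
  end.

Definition ST (X : HDA) (alpha : hpath X) : seq st_entry :=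
  st_from [::] (init X) (psteps alpha).

(* The replacements that move the down-step at position p to position p - 1,   *)
(* and the up-step at position k reached by iterating them.                    *)
Definition moved (X : HDA) (p : nat) (alpha beta : hpath X) : Prop :=
  exists i j, i < j /\
    [\/ replaced p.-1 (Dn j) (Dn i) (Dn i) (Dn j.-1) alpha beta,
        replaced p.-1 (Dn i) (Dn j.-1) (Dn j) (Dn i) alpha beta,
        replaced p.-1 (Up i) (Dn j) (Dn j.-1) (Up i) alpha beta
      | replaced p.-1 (Up j) (Dn i) (Dn i) (Up j.-1) alpha beta].

Inductive start_of (X : HDA) (alpha : hpath X) (p k : nat) : Prop :=
| start_here s i x y t of
    psteps alpha = s ++ [:: (Up i, x), (Dn i, y) & t]
    & (size s).+1 = k & p = k.+1
| start_moved beta of moved p alpha beta & start_of beta p.-1 k.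

Lemma cat_split2 T (s s0 : seq T) e t f g t0 :
  s ++ e :: t = s0 ++ [:: f, g & t0] -> size s = (size s0).+1 ->
  [/\ s = rcons s0 f, e = g & t = t0].
Proof.
move=> E sz; rewrite -(cat_rcons f) in E.
have /(congr1 (take (size s))) := E.
rewrite take_size_cat // take_size_cat ?size_rcons // => sE.
by move: E; rewrite sE => /(congr1 (drop (size (rcons s0 f)))); rewrite !drop_size_cat // => -[-> ->].
Qed.

Lemma start_ofP (X : HDA) (alpha : hpath X) s i y t k :
  psteps alpha = s ++ (Dn i, y) :: t ->
  start_of alpha (size s).+1 k <-> k = start_pos i (rev (unzip1 s)).
Proof.
move=> aE; split=> [|->].
  move pE: (size s).+1 => p H; elim: H s i y t aE pE => {alpha p k}.
    move=> alpha p k s0 i0 x y0 t0 aE0 <- -> s i y t; rewrite aE0 => aE [sz].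
    have [-> [-> _] _] := cat_split2 (esym aE) sz.
    by rewrite /unzip1 map_rcons -/(unzip1 _) rev_rcons /= eqxx size_rev size_map.
  move=> alpha p k beta [i0 [j0 [ij mv]]] _ IH s i y t aE pE.
  by case: mv => -[s0 [x [x' [y0 [t0 [sz]]]]]] /[!aE] aE0 bE;
    (have /(cat_split2 aE0)[-> [-> _] _] : size s = (size s0).+1 by lia);
    rewrite (IH _ _ _ _ bE) ?sz // /unzip1 map_rcons -/(unzip1 _) rev_rcons /=;
    try (case: eqP => [|_]; first lia); congr start_pos; case: ifP; lia.
elim/last_ind: s alpha i y t aE => [|s [f x] IH] alpha i y t aE.
  have := hpathP alpha; rewrite aE /= => -[[[m mlt] _ _] _].
  by move: mlt; rewrite init_dim.
have := hpathP alpha; rewrite aE cat_rcons => /is_hpath_cat[Hs /= [Hf [Hi Ht]]].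
rewrite /unzip1 map_rcons -/(unzip1 _) rev_rcons size_rcons.
have step i' x' g' :
    is_step (last (init X) (unzip2 s)) (Dn i') x' -> is_step x' g' y ->
    (forall beta : hpath X, psteps beta = s ++ [:: (Dn i', x'), (g', y) & t] ->
       moved (size s).+2 alpha beta) ->
    start_of alpha (size s).+2 (start_pos i' (rev (unzip1 s))).
  move=> Hx' Hg' mv.
  have Hb : is_hpath (init X) (s ++ [:: (Dn i', x'), (g', y) & t]).
    by apply/is_hpath_cat.
  by apply: (start_moved (mv (HPath Hb) erefl)); apply: IH.
case: f aE Hf => j aE Hf; last first.
  rewrite /=; case: ltnP => ij.
    have [x' h1 h2] := face_swap ij Hf Hi.
    apply: (step i x' (Dn j.-1)) => // beta bE; exists i, j; split=> //.
    by apply: Or41; exists s, x, x', y, t; rewrite aE cat_rcons.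
  have [x' h1 h2] := @face_swapV _ _ _ j i.+1 _ _ _ ij Hf Hi.
  apply: (step i.+1 x' (Dn j)) => // beta bE; exists j, i.+1; split=> //.
  by apply: Or42; exists s, x, x', y, t; rewrite aE cat_rcons.
rewrite /=; case: eqP => [ji|/eqP ji].
  rewrite size_rev size_map; apply: (@start_here _ _ _ _ s i x y t) => //.
  by rewrite aE cat_rcons ji.
case: ltnP => ij.
  have [x' h1 h2] := face_diamond ij Hi Hf.
  apply: (step i.-1 x' (Up j)) => // beta bE; exists j, i; split=> //.
  by apply: Or43; exists s, x, x', y, t; rewrite aE cat_rcons.
have {}ij : i < j by rewrite ltn_neqAle eq_sym ji.
have [x' h1 h2] := face_diamond ij Hf Hi.
apply: (step i x' (Up j.-1)) => // beta bE; exists i, j; split=> //.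
by apply: Or44; exists s, x, x', y, t; rewrite aE cat_rcons.
Qed.

Inductive bisim_symbol := Subsumed | Subsumes | Similar | Extends.

Section Bisimulations.
Variable J : bisim_symbol -> bool.

Definition simulates (Y Z : HDA) (R : hpath Y -> hpath Z -> Prop) : Prop :=
  R (hpath0 Y) (hpath0 Z) /\
  forall alpha beta, R alpha beta ->
  ST alpha = ST beta /\
  (forall alpha', hprefix alpha alpha' ->
     exists2 beta', hprefix beta beta' & R alpha' beta') /\
  (J Subsumed -> forall l alpha', subsumed l alpha alpha' ->
     exists2 beta', subsumed l beta beta' & R alpha' beta') /\
  (J Subsumes -> forall l alpha', subsumed l alpha' alpha ->
     exists2 beta', subsumed l beta' beta & R alpha' beta') /\
  (J Similar -> forall l alpha', similar l alpha' alpha ->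
     exists2 beta', similar l beta' beta & R alpha' beta') /\
  (J Extends -> forall alpha', hprefix alpha' alpha ->
     exists2 beta', hprefix beta' beta & R alpha' beta').

Definition bisimulation (Y Z : HDA) (R : hpath Y -> hpath Z -> Prop) : Prop :=
  simulates R /\ simulates (fun beta alpha => R alpha beta).

Definition bisimilar (Y Z : HDA) : Prop :=
  exists R : hpath Y -> hpath Z -> Prop, bisimulation R.

End Bisimulations.

End Box.

Definition shp (s : bisim_symbol) : bool :=
  if s is Subsumed then true else false.

Definition qhp (s : bisim_symbol) : bool :=
  match s with Subsumed | Similar => true | _ => false end.

(* All symbols but the one of l-similarity.                                    *)
Definition all_but_similar (s : bisim_symbol) : bool :=
  if s is Similar then false else true.

(* Main.v *)
Require Import Defs.
From mathcomp Require Import all_boot.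

(** The counterexample lives in the 4-cube on the events [a; b; d; d]; write a
    cell as a word over 0, 1, * with one letter per event. Let [X_k] consist of
    the faces of [**00], [1**0], [110*] and of [*1*0] if [k] is true, [*10*] if it
    is false: once [b] has ended, the event [d] that is concurrent with [a] is
    the first or the second one.

    Exchanging the two [d]'s along exactly those paths on which [b] ends before
    [a] matches the paths of [X_true] with those of [X_false], without changing
    steps and labels. A path and a path subsuming it pass through the same sets
    of ended events, so this matching respects everything but similarity.

    Swapping the ends of [a] and [b] does change these sets. Let both events end,
    [a] first, and start the [d] that is concurrent with [b] in [1**0]:
    subsumption forces the partner to start the first [d] as well. After
    swapping the two ends, moving the start of [d] before the end of [a] is
    possible in [*1*0], hence in [X_true] only. *)

Set Implicit Arguments.
Unset Strict Implicit.
Unset Printing Implicit Defensive.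

(** * Words over [0], [1], [*] and their faces *)

Notation word := (seq (option bool)).

(* [None] encodes the letter [*]: a coordinate whose event is active. *)
Definition stars (w : word) : seq nat :=
  [seq p <- iota 0 (size w) | nth (Some false) w p == None].

Definition below (v w : word) : bool :=
  all2 (fun x y => (y == None) || (x == y)) v w.

(** The index [i] counts active events only and is first turned into a position of the word; the
    result is [None] when at most [i] events are active. *)
Definition wface (k : bool) (i : nat) (w : word) : option word :=
  omap (fun p => set_nth None w p (Some k)) (onth (stars w) i).

Lemma mem_stars (w : word) p :
  (p \in stars w) = (p < size w) && (nth None w p == None).
Proof.
rewrite mem_filter mem_iota add0n andbC /=; case: ltnP => //= pw.
by rewrite (set_nth_default None).
Qed.

Lemma stars_sorted (w : word) : sorted ltn (stars w).
Proof. exact: sorted_filter ltn_trans _ _ (iota_ltn_sorted _ _). Qed.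

(** * Subcomplexes of a labelled cube, with cells encoded as words *)

Section Complex.
Variables (Sigma : Type) (L : seq Sigma) (P : pred word).
Hypothesis P_size : forall w, P w -> size w = size L.
Hypothesis P_below : forall v w, below v w -> P w -> P v.

Definition cube : conclist Sigma := Conclist [ffun p => tnth (in_tuple L) p].

Definition mor_word U (m : box_mor U cube) : word :=
  [seq bsgn m p | p <- enum 'I_(size L)].

Lemma size_mor_word U (m : box_mor U cube) : size (mor_word m) = size L.
Proof. by rewrite size_map size_enum_ord. Qed.

Lemma nth_mor_word U (m : box_mor U cube) (p : 'I_(size L)) :
  nth None (mor_word m) p = bsgn m p.
Proof. by rewrite (nth_map p) ?size_enum_ord // nth_ord_enum. Qed.

Lemma stars_mor_word U (m : box_mor U cube) :
  stars (mor_word m) = [seq val (bfun m t) | t <- enum 'I_(dim U)].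
Proof.
have [fI fM _ fS] := box_morP m.
apply: (irr_sorted_eq ltn_trans ltnn (stars_sorted _)).
  apply: (homo_sorted (e := fun s t : 'I_(dim U) => s < t)).
    move=> s t st; rewrite ltn_neqAle (fM _ _ (ltnW st)) andbT.
    by apply/eqP => /val_inj/fI E; rewrite E ltnn in st.
  by have := iota_ltn_sorted 0 (dim U); rewrite -val_enum_ord sorted_map.
move=> p; rewrite mem_stars size_mor_word.
apply/andP/mapP => [[pL /eqP]|[t _ ->]].
  rewrite -[p]/(val (Ordinal pL)) nth_mor_word => /((fS (Ordinal pL)).1)[t tp].
  by exists t; rewrite ?mem_enum // tp.
split; first exact: ltn_ord.
by rewrite nth_mor_word; apply/eqP/(fS (bfun m t)).2; exists t.
Qed.

Lemma size_stars U (m : box_mor U cube) : size (stars (mor_word m)) = dim U.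
Proof. by rewrite stars_mor_word size_map size_enum_ord. Qed.

Lemma nth_stars U (m : box_mor U cube) (t : 'I_(dim U)) :
  nth 0 (stars (mor_word m)) t = bfun m t.
Proof. by rewrite stars_mor_word (nth_map t) ?size_enum_ord // nth_ord_enum. Qed.

Lemma below_nth v w : size v = size w ->
  (forall p, p < size v -> nth None w p <> None -> nth None v p = nth None w p) ->
  below v w.
Proof.
elim: v w => [|x v IH] [|y w] //= [sz] H; apply/andP; split.
  by case: eqP => //= yN; apply/eqP/(H 0).
by apply: IH => // p pv; apply: (H p.+1).
Qed.

Lemma mor_word_comp U V (m : box_mor V cube) (f : box_mor U V) :
  below (mor_word (box_comp m f)) (mor_word m).
Proof.
apply: below_nth => [|p]; rewrite size_mor_word ?size_mor_word // => pL.
rewrite -[p]/(val (Ordinal pL)) !nth_mor_word => mp; apply: comp_sgn_out.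
by move=> t tp; apply: mp; have [_ _ _ ->] := box_morP m; exists t.
Qed.

(** A subpresheaf of the presheaf represented by the cube: restriction is precomposition, which
    stays inside because [P] is closed under faces. *)
Definition complex_cell (U : conclist Sigma) : Type :=
  {m : box_mor U cube | P (mor_word m)}.

Lemma complex_cell_eq U (x y : complex_cell U) : sval x = sval y -> x = y.
Proof.
case: x y => [m p] [n q] /= E; subst n; congr exist; exact: bool_irrelevance.
Qed.

Definition complex_map U V (f : box_mor U V) (x : complex_cell V) : complex_cell U :=
  exist _ (box_comp (sval x) f) (P_below (mor_word_comp _ _) (svalP x)).

Definition complex : precubical Sigma.
Proof.
apply: (@Precubical Sigma complex_cell complex_map) => [U x|U V W g f x];
  apply: complex_cell_eq.
  exact: box_compf1.
exact: box_compA.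
Defined.

Definition cword (x : cell complex) : word := mor_word (sval (tagged x)).

Lemma cwordP x : P (cword x).
Proof. exact: svalP (tagged x). Qed.

(** The letters give the signs, and the positions of [*] in increasing order give the injection; the
    labels of the source are then pulled back from the cube. *)
Lemma cword_inj : injective cword.
Proof.
move=> [U [m p]] [V [m' p']]; rewrite /cword /= => E.
have : dim U = dim V by rewrite -(size_stars m) E size_stars.
case: U V m p m' p' E => [n l] [n' l'] /= m p m' p' E nn'; subst n'.
have fE t : bfun m t = bfun m' t.
  by apply: val_inj; rewrite /= -[LHS]nth_stars -[RHS]nth_stars E.
have sE : bsgn m =1 bsgn m' by move=> q; rewrite -!nth_mor_word E.
have El : l = l'.
  apply/ffunP => t; have [_ _ pL _] := box_morP m; have [_ _ qL _] := box_morP m'.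
  by rewrite -[l t]pL -[l' t]qL fE.
subst l'; have Em := box_mor_eq fE sE; subst m'.
by rewrite (bool_irrelevance p p').
Qed.

Lemma size_stars_cword (x : cell complex) : size (stars (cword x)) = cdim x.
Proof. exact: size_stars. Qed.

Lemma cword_delta (x : cell complex) (i : 'I_(cdim x)) k :
  Some (cword (delta i k)) = wface k i (cword x).
Proof.
case: x i => [U [m p]]; rewrite /cdim /cword /delta /= => i.
rewrite /wface onthE (nth_map 0) ?size_stars //= nth_stars; congr Some.
have [fI _ _ fS] := box_morP m.
have sz : size (set_nth None (mor_word m) (bfun m i) (Some k)) = size L.
  by rewrite size_set_nth size_mor_word; apply/maxn_idPr/ltn_ord.
apply: (@eq_from_nth _ None) => [|q]; rewrite size_mor_word ?sz // => qL.
rewrite nth_set_nth /= -[q]/(val (Ordinal qL)) !nth_mor_word.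
move: (Ordinal qL) => {qL}q.
have [/existsP[t /eqP <-]|/existsPn nom] := boolP [exists t, bfun m t == q].
  rewrite comp_sgn_in ffunE (inj_eq val_inj) (inj_eq fI).
  by case: eqP => // _; apply/esym/(fS (bfun m t)).2; exists t.
rewrite comp_sgn_out => [|t]; last by apply/eqP; apply: nom.
by rewrite (inj_eq val_inj) eq_sym (negbTE (nom i)).
Qed.

Lemma is_faceP k i (x y : cell complex) :
  is_face k i x y <-> wface k i (cword x) = Some (cword y).
Proof.
split=> [[i0 <- ->]|]; first exact/esym/cword_delta.
have [ix|ix] := ltnP i (cdim x); last first.
  by rewrite /wface onth_default // size_stars_cword.
rewrite -[i]/(val (Ordinal ix)) -cword_delta => -[/cword_inj E].
by exists (Ordinal ix).
Qed.

Lemma cword_surj w : P w -> exists x : cell complex, cword x = w.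
Proof.
move=> Pw; have wL := P_size Pw.
pose e := [ffun p : 'I_(size L) => nth None w p].
pose A := [pred p | e p == None].
pose f := [ffun t : 'I_#|A| => enum_val t].
pose U := Conclist [ffun t => lab cube (f t)].
have fP : @is_box_mor _ U cube f e.
  split=> [s t|s t st|t|u]; rewrite ?ffunE //.
  - exact: enum_val_inj.
  - have tr : transitive (fun p q : 'I_(size L) => p <= q).
      by move=> ? ? ?; apply: leq_trans.
    have As : sorted (fun p q : 'I_(size L) => p <= q) (enum A).
      rewrite /enum_mem -enumT; apply: sorted_filter => //.
      by have := iota_sorted 0 (size L); rewrite -val_enum_ord sorted_map.
    have x0 := enum_val t; rewrite (enum_val_nth x0 s) (enum_val_nth x0 t).
    by apply: (sorted_leq_nth tr) => //; rewrite ?inE -?cardE.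
  split=> [uN|[t]].
    have uA : u \in A by rewrite inE ffunE uN.
    by exists (enum_rank_in uA u); rewrite ffunE enum_rankK_in.
  rewrite ffunE => <-; have := enum_valP t.
  by rewrite inE ffunE => /eqP.
have E : mor_word (BoxMor fP) = w.
  apply: (@eq_from_nth _ None) => [|q]; rewrite size_mor_word // => qL.
  by rewrite -[q]/(val (Ordinal qL)) nth_mor_word ffunE.
have PE : P (mor_word (BoxMor fP)) by rewrite E.
by exists (Tagged complex_cell (@exist _ (fun m : box_mor U cube => P (mor_word m)) _ PE)).
Qed.

(** * Paths and ST-traces on words *)

Definition wstep (w : word) (phi : step) (w' : word) : bool :=
  match phi with
  | Up i => wface false i w' == Some w
  | Dn i => wface true i w == Some w'
  end.

Fixpoint wpath (w : word) (s : seq (step * word)) : bool :=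
  if s is (phi, w') :: s' then [&& P w', wstep w phi w' & wpath w' s'] else true.

Definition code (c : step * cell complex) : step * word := (c.1, cword c.2).

Lemma code_inj : injective code.
Proof. by move=> [f x] [g y] [-> /cword_inj ->]. Qed.

Lemma is_stepP (x y : cell complex) phi :
  is_step x phi y <-> wstep (cword x) phi (cword y).
Proof. by case: phi => i /=; rewrite is_faceP; split=> /eqP. Qed.

Lemma wpath_code x s : is_hpath x s -> wpath (cword x) (map code s).
Proof.
by elim: s x => [|[phi y] s IH] x //= [/is_stepP -> /IH ->]; rewrite cwordP.
Qed.

Lemma wpath_decode x cs :
  wpath (cword x) cs -> exists2 s, is_hpath x s & map code s = cs.
Proof.
elim: cs x => [|[phi w] cs IH] x /=; first by exists [::].
case/and3P => /cword_surj[y <-] xy /IH[s ys <-].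
by exists ((phi, y) :: s); split=> //; apply/is_stepP.
Qed.

Definition wlabel (w : word) (i : nat) : option Sigma :=
  obind (onth L) (onth (stars w) i).

Lemma label_cword (x : cell complex) i : label x i = wlabel (cword x) i.
Proof.
rewrite /label /wlabel; case: insubP => [t it <-|ix]; last first.
  by rewrite onth_default // size_stars_cword leqNgt.
case: x t it => U [m p]; rewrite /cword /cdim /= => t it.
rewrite onthE (nth_map 0) ?size_stars //= nth_stars.
have [_ _ <- _] := box_morP m; rewrite ffunE; apply/esym.
exact: (tnth_onth _ (in_tuple L) _).1.
Qed.

Fixpoint wtrace (r : seq step) (w : word) (s : seq (step * word)) :
    seq (st_entry Sigma) :=
  if s is (phi, w') :: s' then
    match phi with
    | Up i => Started (wlabel w' i)
    | Dn i => Ended (wlabel w i) (start_pos i r)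
    end :: wtrace (phi :: r) w' s'
  else [::].

Lemma st_from_code r x s : st_from r x s = wtrace r (cword x) (map code s).
Proof.
by elim: s r x => [|[phi y] s IH] r x //=; rewrite IH;
  case: phi => i /=; rewrite label_cword.
Qed.

Definition wreplaced l f g f' g' (u v : seq (step * word)) : Prop :=
  exists s x x' y t,
  [/\ (size s).+1 = l, u = s ++ [:: (f, x), (g, y) & t]
    & v = s ++ [:: (f', x'), (g', y) & t]].

Section Paths.
Variables (x0 : cell complex) (x0_dim : cdim x0 = 0).

Definition complex_hda : HDA Sigma := MkHDA x0_dim.
Definition hcode (alpha : hpath complex_hda) : seq (step * word) :=
  map code (psteps alpha).

Lemma hcodeP alpha : wpath (cword x0) (hcode alpha).
Proof. exact/wpath_code/(hpathP alpha). Qed.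

Lemma hcode_surj cs : wpath (cword x0) cs -> exists alpha, hcode alpha = cs.
Proof. by case/wpath_decode => s sP <-; exists (@HPath _ complex_hda s sP). Qed.

Lemma ST_hcode alpha : ST alpha = wtrace [::] (cword x0) (hcode alpha).
Proof. exact: st_from_code. Qed.

Lemma hprefix_hcode alpha beta :
  hprefix alpha beta <-> exists t, hcode beta = hcode alpha ++ t.
Proof.
rewrite /hprefix /hcode; split=> [[t ->]|[t E]].
  by exists (map code t); rewrite map_cat.
exists (drop (size (psteps alpha)) (psteps beta)).
apply: (inj_map code_inj); rewrite map_cat map_drop E.
by rewrite -(size_map code) drop_size_cat.
Qed.

(** For the backward direction, a cut of the coded path lifts to the path itself, and injectivity of
    the code identifies the parts shared by both paths. *)
Lemma replaced_hcode l f g f' g' alpha beta :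
  replaced l f g f' g' alpha beta <-> wreplaced l f g f' g' (hcode alpha) (hcode beta).
Proof.
rewrite /hcode /replaced; split=> [[s [x [x' [y [t [sl -> ->]]]]]]|].
  exists (map code s), (cword x), (cword x'), (cword y), (map code t).
  by rewrite !map_cat size_map.
case=> s [x [x' [y [t [sl aE bE]]]]].
have split_at (u : seq (step * cell complex)) h k v w :
    map code u = w ++ [:: h, k & v] ->
    exists u1 z1 z2 u2, [/\ u = u1 ++ [:: z1, z2 & u2], map code u1 = w,
      code z1 = h, code z2 = k & map code u2 = v].
  elim: w u => [|e w IH] [|z u] //=.
    by case: u => //= z' u [<- <- <-]; exists [::], z, z', u.
  by case=> <- /IH[u1 [z1 [z2 [u2 [-> <- <- <- <-]]]]]; exists (z :: u1), z1, z2, u2.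
have [s1 [[f1 x1] [[g1 y1] [t1 [-> Es [<- _] [<- Ey] Et]]]]] := split_at _ _ _ _ _ aE.
have [s2 [[f2 x2] [[g2 y2] [t2 [-> Es' [<- _] [<- Ey'] Et']]]]] := split_at _ _ _ _ _ bE.
exists s1, x1, x2, y1, t1; split=> //; first by rewrite -sl -Es size_map.
have -> : s1 = s2 by apply: (inj_map code_inj); rewrite Es.
have -> : t1 = t2 by apply: (inj_map code_inj); rewrite Et.
by have -> : y1 = y2 by apply: cword_inj; rewrite Ey.
Qed.
End Paths.
End Complex.

(** * The two complexes, with properties checked by enumeration *)

Definition words4 : seq word :=
  let s := [:: None; Some false; Some true] in
  [seq x :: w | x <- s, w <- [seq x :: w | x <- s, w <- [seq [:: x; y] | x <- s, y <- s]]].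

Lemma mem_words4 (w : word) : size w = 4 -> w \in words4.
Proof.
by case: w => [|[[]|] [|[[]|] [|[[]|] [|[[]|] [|]]]]].
Qed.

Definition facets (k : bool) : seq word :=
  let O := Some false in let I := Some true in let S := None in
  [:: [:: S; S; O; O]; [:: I; S; S; O];
      if k then [:: S; I; S; O] else [:: S; I; O; S]; [:: I; I; O; S]].

Definition allowed (k : bool) (w : word) : bool := has (below w) (facets k).

Lemma below_trans (u v w : word) : below u v -> below v w -> below u w.
Proof.
elim: u v w => [|x u IH] [|y v] [|z w] //= /andP[xy uv] /andP[yz vw].
rewrite (IH _ _ uv vw) andbT; case/orP: yz => [->//|/eqP <-].
by case/orP: xy => ->; rewrite ?orbT.
Qed.

Lemma allowed_below k (v w : word) : below v w -> allowed k w -> allowed k v.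
Proof. by move=> vw /hasP[m mk wm]; apply/hasP; exists m; last exact: below_trans wm. Qed.

Lemma size_allowed k (w : word) : allowed k w -> size w = 4.
Proof.
have H (v u : word) : below v u -> size v = size u.
  by elim: v u => [|x v IH] [|y u] //= /andP[_ /IH ->].
by case/hasP => m mk /H ->; move: mk; case: k; rewrite !inE => /or4P[] /eqP->.
Qed.

(** Turns a claim about all cells into a computation, since allowed words occur in an explicit
    finite list. In the same way [wface_ge] will bound the indices to be checked. *)
Lemma allowedP k (Q : pred word) :
  all Q [seq w <- words4 | allowed k w] -> forall w, allowed k w -> Q w.
Proof.
move=> /allP H w wk; apply: H.
by rewrite mem_filter wk mem_words4 ?(size_allowed wk).
Qed.

Lemma wface_ge e i (w : word) : size w <= i -> wface e i w = None.
Proof.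
move=> wi; rewrite /wface onth_default // (leq_trans _ wi) //.
by rewrite size_filter -[X in _ <= X](size_iota 0) count_size.
Qed.

(** * The exchange of the two [d]-letters *)

Definition ended (p : nat) (w : word) : bool := nth None w p == Some true.
Definition b_first (w : word) : bool := ended 1 w && ~~ ended 0 w.
Definition swap (w : word) : word := if w is [:: x; y; z; t] then [:: x; y; t; z] else w.

Lemma swapK : involutive swap.
Proof. by case=> [|x [|y [|z [|t [|]]]]]. Qed.

Lemma ended_swap p w : p < 2 -> ended p (swap w) = ended p w.
Proof. by case: p => [|[|]] // _; case: w => [|x [|y [|z [|t [|]]]]]. Qed.

Lemma b_first_swap w : b_first (swap w) = b_first w.
Proof. by rewrite /b_first !ended_swap. Qed.

Lemma wfaceP e i (w v : word) : wface e i w = Some v ->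
  exists p, [/\ p < size w, nth None w p = None & v = set_nth None w p (Some e)].
Proof.
rewrite /wface; case E: (onth _ _) => [p|] //= [<-]; exists p.
have: p \in stars w by apply/onthP; exists i.
by rewrite mem_stars => /andP[pw /eqP].
Qed.

Lemma ended_wface_true i p (w v : word) :
  wface true i w = Some v -> ended p w -> ended p v.
Proof.
by case/wfaceP => q [_ _ ->]; rewrite /ended nth_set_nth /=; case: (p == q).
Qed.

Lemma ended_wface_false i p (w v : word) :
  wface false i w = Some v -> ended p v = ended p w.
Proof.
case/wfaceP => q [_ wq ->]; rewrite /ended nth_set_nth /=.
by case: (p =P q) => [->|//]; rewrite wq.
Qed.

Lemma b_first_up i (w v : word) : wface false i w = Some v -> b_first v = b_first w.
Proof. by move=> wv; rewrite /b_first !(ended_wface_false _ wv). Qed.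

Lemma ended_wstep p w phi v : wstep w phi v -> ended p w -> ended p v.
Proof.
by case: phi => i /= /eqP => [/ended_wface_false->|/ended_wface_true H /H].
Qed.

(** Fails just when [a] has ended and [b] has not, which never happens on a path where [b] ends
    first. *)
Definition swappable (w : word) : bool := ended 1 w || ~~ ended 0 w.

(** Only the third facet depends on [k]. Its faces with [a] ended lie in [11*0] or [110*], which
    both complexes contain; its other faces are [b_first]. *)
Lemma allowed_early k w : allowed k w -> ~~ b_first w -> allowed (~~ k) w.
Proof.
move=> wk; apply/implyP; move: w wk; apply: allowedP.
by case: k; vm_compute.
Qed.

(** Such a cell lies in [**00], where both [d]-letters are [0]. *)
Lemma swap_early k w : allowed k w -> ~~ ended 0 w -> ~~ ended 1 w -> swap w = w.
Proof.
move=> wk H0 H1; apply/eqP; move: H0; apply/implyP; move: H1; apply/implyP.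
by move: w wk; apply: allowedP; case: k; vm_compute.
Qed.

(** The exchange fixes [**00], carries the third facet of one complex to that of the other, and
    interchanges [11*0] and [110*]; a swappable face of [1**0] lies in [11*0]. *)
Lemma allowed_swap k w : allowed k w -> swappable w -> allowed (~~ k) (swap w).
Proof.
move=> wk; apply/implyP; move: w wk; apply: allowedP.
by case: k; vm_compute.
Qed.

(** The position of an active event, with 2 and 3 identified because both carry [d]: a computable
    substitute for the label in the arbitrary type [Sigma]. *)
Definition colour (w : word) (i : nat) : option nat := omap (minn 2) (onth (stars w) i).

(** At most one [d] is active in an allowed word, so the exchange preserves the order of the active
    events. *)
Lemma wface_swap k e i w : allowed k w -> swappable w ->
  wface e i (swap w) = omap swap (wface e i w).
Proof.
move=> wk; have sw := size_allowed wk.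
have [iw|wi] := ltnP i (size w); last first.
  rewrite !wface_ge //; move: sw wi.
  by case: w {wk} => [|x [|y [|z [|t [|]]]]].
move=> ws; apply/eqP; have: i \in iota 0 4 by rewrite mem_iota -sw.
move: i {iw}; apply/allP; move: ws; apply/implyP.
by move: w wk {sw}; apply: allowedP; case: e; case: k; vm_compute.
Qed.

Lemma colour_swap k i w : allowed k w -> swappable w -> colour (swap w) i = colour w i.
Proof.
move=> wk; have sw := size_allowed wk.
have [iw|wi] := ltnP i (size w); last first.
  have := @wface_ge true i w wi; have := @wface_ge true i (swap w).
  have -> : size (swap w) = size w by move: sw; case: w {wk wi} => [|x [|y [|z [|t [|]]]]].
  rewrite /colour /wface => /(_ wi); by do 2 case: onth.
move=> ws; apply/eqP; have: i \in iota 0 4 by rewrite mem_iota -sw.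
move: i {iw}; apply/allP; move: ws; apply/implyP.
by move: w wk {sw}; apply: allowedP; case: k; vm_compute.
Qed.

(** * The matching of paths *)

Notation coded_step := (step * word)%type.

Definition swap_code (c : coded_step) : coded_step := (c.1, swap c.2).
Definition early_b (c : coded_step) : bool := b_first c.2.

Definition twist (cs : seq coded_step) : seq coded_step :=
  if has early_b cs then map swap_code cs else cs.

Lemma has_early_b_swap cs : has early_b (map swap_code cs) = has early_b cs.
Proof. by rewrite has_map; apply: eq_has => c; apply: b_first_swap. Qed.

Lemma twistK : involutive twist.
Proof.
move=> cs; rewrite /twist; case E: (has early_b cs); rewrite ?has_early_b_swap E //.
by apply: mapK => -[f w]; rewrite /swap_code /= swapK.
Qed.

Lemma ended_wpath P p w cs : wpath P w cs -> ended p w -> all (fun c => ended p c.2) cs.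
Proof.
elim: cs w => [|[f v] cs IH] w //= /and3P[_ wv vcs] wp.
by have vp := ended_wstep wv wp; rewrite vp (IH v).
Qed.

Lemma wpath_cat P w cs ds :
  wpath P w (cs ++ ds) = wpath P w cs && wpath P (last w (map snd cs)) ds.
Proof. by elim: cs w => [|[f v] cs IH] w //=; rewrite IH !andbA. Qed.

Lemma ended0_no_early_b (cs : seq coded_step) :
  all (fun c => ended 0 c.2) cs -> ~~ has early_b cs.
Proof.
rewrite -all_predC; apply: sub_all => c.
by rewrite /early_b /b_first /= => ->; rewrite andbF.
Qed.

Lemma before_early_b P w cs ds : wpath P w (cs ++ ds) -> has early_b ds ->
  all (fun c => ~~ ended 0 c.2) cs.
Proof.
elim: cs w => [|[f v] cs IH] w //= /and3P[_ _ vp] hb; rewrite (IH _ vp hb) andbT.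
apply/negP => /(ended_wpath vp); rewrite all_cat => /andP[_ /ended0_no_early_b].
by rewrite hb.
Qed.

(** Before [b] ends, [a] cannot have ended, or no later word would be [b_first]; from the end of [b]
    on, the first disjunct holds. *)
Lemma early_b_swappable P w cs : wpath P w cs -> has early_b cs ->
  all (fun c => swappable c.2) cs.
Proof.
elim: cs w => [|[f v] cs IH] w //= /and3P[_ _ vcs].
rewrite {1}/early_b /swappable /=; case: (boolP (ended 1 v)) => [v1 _|v1] /=.
  by apply: sub_all (ended_wpath vcs v1) => c; rewrite /swappable => ->.
rewrite /b_first (negbTE v1) /= => hb; rewrite (IH _ vcs hb) andbT.
by apply/negP => /(ended_wpath vcs)/ended0_no_early_b; rewrite hb.
Qed.

Lemma wpath_early k w cs : wpath (allowed k) w cs -> ~~ has early_b cs ->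
  wpath (allowed (~~ k)) w cs.
Proof.
elim: cs w => [|[f v] cs IH] w //= /and3P[vk -> vcs].
by rewrite negb_or => /andP[vb /(IH _ vcs) ->]; rewrite allowed_early.
Qed.

Lemma wstep_swap k w phi v : allowed k w -> allowed k v -> swappable w -> swappable v ->
  wstep w phi v -> wstep (swap w) phi (swap v).
Proof.
move=> wk vk ws vs; case: phi => i /= /eqP E.
  by rewrite (wface_swap _ _ vk) // E.
by rewrite (wface_swap _ _ wk) // E.
Qed.

Lemma wpath_swap k w cs : allowed k w -> swappable w ->
  all (fun c => swappable c.2) cs -> wpath (allowed k) w cs ->
  wpath (allowed (~~ k)) (swap w) (map swap_code cs).
Proof.
elim: cs w => [|[f v] cs IH] w wk ws //= /andP[vs css] /and3P[vk wv vcs].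
by rewrite allowed_swap // (wstep_swap wk) //= IH.
Qed.

Definition origin : word := nseq 4 (Some false).

Lemma wpath_twist k cs : wpath (allowed k) origin cs ->
  wpath (allowed (~~ k)) origin (twist cs).
Proof.
move=> ok; rewrite /twist; case: ifPn => [hb|]; last exact: wpath_early.
by have := wpath_swap (w := origin) _ _ (early_b_swappable ok hb) ok; apply; case: k {ok}.
Qed.

(** The delicate case is a first [b_first] word in [ds]: then [cs] is exchanged as part of the
    longer path, but not by itself. Neither [a] nor [b] has ended on [cs], so the exchange does
    nothing there. *)
Lemma twist_cat k cs ds : wpath (allowed k) origin (cs ++ ds) ->
  exists es, twist (cs ++ ds) = twist cs ++ es.
Proof.
move=> ok; rewrite /twist has_cat; case: (boolP (has early_b cs)) => [hb|nb] /=.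
  by rewrite map_cat; exists (map swap_code ds).
case: (boolP (has early_b ds)) => [hb|_]; last by exists ds.
exists (map swap_code ds); rewrite map_cat; congr (_ ++ _).
have c0 := before_early_b ok hb; move: ok; rewrite wpath_cat => /andP[ok _].
elim: cs origin ok nb c0 => [|[f v] cs IH] w //= /and3P[vk _ vcs].
rewrite negb_or => /andP[vb nb] /andP[v0 c0]; rewrite (IH v) // /swap_code /=.
by rewrite (swap_early vk) //; move: vb; rewrite /early_b /b_first /= v0 andbT.
Qed.

Lemma b_first_last P w cs : wpath P w cs -> b_first (last w (map snd cs)) ->
  ~~ b_first w -> has early_b cs.
Proof.
elim: cs w => [|[f v] cs IH] w /= => [_ -> //|/and3P[_ _ vcs] hl _].
case: (boolP (early_b (f, v))) => //= vb; exact: (IH v).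
Qed.

(** The paths differ only in [x] versus [x']. Up-steps preserve [b_first], so [x] agrees in this
    respect with the cell before it and [x'] with the cell after it. Both neighbours are shared,
    hence [twist] treats the two paths alike. *)
Lemma twist_replaced P l i j i' j' u v :
  wpath P origin u -> wpath P origin v ->
  wreplaced l (Up i) (Dn j) (Dn j') (Up i') u v ->
  wreplaced l (Up i) (Dn j) (Dn j') (Up i') (twist u) (twist v).
Proof.
move=> up vp [s [x [x' [y [t [sl uE vE]]]]]].
have E : has early_b u = has early_b v.
  move: up vp; rewrite uE vE !wpath_cat => /andP[sp /and3P[_ wx _]] /andP[_ /and3P[_ _]].
  case/and3P=> _ x'y _; move: wx x'y => /= /eqP/b_first_up wx /eqP/b_first_up x'y.
  rewrite !has_cat /= /early_b /= x'y -wx; case: (boolP (b_first _)) => //= H.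
    (* As [origin] is not [b_first], the cell before [x] is an entry of [s]. *)
    by rewrite (b_first_last sp H).
  by case: (b_first y); rewrite ?orbT.
rewrite /twist -E; case: (has early_b u); last by exists s, x, x', y, t.
exists (map swap_code s), (swap x), (swap x'), (swap y), (map swap_code t).
by rewrite uE vE !map_cat size_map.
Qed.

(** * The matching as a bisimulation *)

Section Counterexample.
Variables (Sigma : Type) (a b d : Sigma).
Let L := [:: a; b; d; d].

Lemma wlabel_colour (w : word) i : size w = 4 ->
  wlabel L w i = obind (onth [:: a; b; d]) (colour w i).
Proof.
rewrite /wlabel /colour => sw; case E: (onth _ _) => [p|] //=.
have: p \in stars w by apply/onthP; exists i.
by rewrite mem_stars sw => /andP[+ _]; case: p {E} => [|[|[|[|]]]].
Qed.

(** Labels depend on the colour only, and start positions are computed from the step indices, which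
    the exchange keeps. *)
Lemma wtrace_swap k r w cs : allowed k w -> swappable w ->
  all (fun c => swappable c.2) cs -> wpath (allowed k) w cs ->
  wtrace L r (swap w) (map swap_code cs) = wtrace L r w cs.
Proof.
have H v : allowed k v -> swappable v -> wlabel L (swap v) =1 wlabel L v.
  move=> vk vs i; have sv := size_allowed (allowed_swap vk vs).
  by rewrite !wlabel_colour ?(size_allowed vk) // (colour_swap _ vk).
elim: cs r w => [|[f v] cs IH] r w wk ws //= /andP[vs css] /and3P[vk wv vcs].
by rewrite IH //; case: f {wv} => i; rewrite H.
Qed.

Lemma wtrace_twist k cs : wpath (allowed k) origin cs ->
  wtrace L [::] origin (twist cs) = wtrace L [::] origin cs.
Proof.
move=> ok; rewrite /twist; case: ifP => // hb.
by have := wtrace_swap [::] (w := origin) _ _ (early_b_swappable ok hb) ok; apply=> //.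
Qed.

Let X k := complex L (@allowed_below k).
Variable x0 : forall k, cell (X k).
Hypothesis x0E : forall k, cword (x0 k) = origin.

Lemma x0_dim k : cdim (x0 k) = 0.
Proof. by rewrite -size_stars_cword x0E. Qed.

Let H k := complex_hda (x0_dim k).

Lemma hcode_wpath k (alpha : hpath (H k)) : wpath (allowed k) origin (hcode alpha).
Proof. by have := hcodeP alpha; rewrite x0E. Qed.

Lemma hcode_ex k cs : wpath (allowed k) origin cs ->
  exists alpha : hpath (H k), hcode alpha = cs.
Proof.
by rewrite -(x0E k) => /(@hcode_surj Sigma L _ (@size_allowed k) _ (x0 k) (x0_dim k)).
Qed.

Lemma twist_hcode_ex k (alpha : hpath (H k)) :
  exists beta : hpath (H (~~ k)), hcode beta = twist (hcode alpha).
Proof. exact/hcode_ex/wpath_twist/hcode_wpath. Qed.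

Lemma twist_replaced_hpath k l i j i' j' (alpha alpha' : hpath (H k))
    (beta beta' : hpath (H (~~ k))) :
  hcode beta = twist (hcode alpha) -> hcode beta' = twist (hcode alpha') ->
  replaced l (Up i) (Dn j) (Dn j') (Up i') alpha alpha' ->
  replaced l (Up i) (Dn j) (Dn j') (Up i') beta beta'.
Proof.
move=> E E' /replaced_hcode aa'; apply/replaced_hcode; rewrite E E'.
exact: twist_replaced (hcode_wpath _) (hcode_wpath _) aa'.
Qed.

Lemma twist_subsumed k l (alpha alpha' : hpath (H k)) (beta beta' : hpath (H (~~ k))) :
  hcode beta = twist (hcode alpha) -> hcode beta' = twist (hcode alpha') ->
  subsumed l alpha alpha' -> subsumed l beta beta'.
Proof.
move=> E E' [i [j [ij aa']]]; exists i, j; split=> //.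
by case: aa' => /(twist_replaced_hpath E' E); [left|right].
Qed.

Lemma twist_hprefix k (alpha alpha' : hpath (H k)) (beta beta' : hpath (H (~~ k))) :
  hcode beta = twist (hcode alpha) -> hcode beta' = twist (hcode alpha') ->
  hprefix alpha alpha' -> hprefix beta beta'.
Proof.
move=> E E' /hprefix_hcode[t aa']; apply/hprefix_hcode; rewrite E E' aa'.
by apply: (@twist_cat k); rewrite -aa'; apply: hcode_wpath.
Qed.

(** Every clause is answered by the twist of [alpha']. The separate [k2] and the characterisation of
    [R] up to equivalence let the lemma serve both directions, the reverse relation being again a
    twist by [twistK]. *)
Lemma simulates_twist k1 k2 (R : hpath (H k1) -> hpath (H k2) -> Prop) :
  k2 = ~~ k1 -> (forall alpha beta, R alpha beta <-> hcode beta = twist (hcode alpha)) ->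
  simulates all_but_similar R.
Proof.
move=> E; subst k2 => RP; split; first exact/RP.
move=> alpha beta /RP ab; split.
  rewrite !ST_hcode ab !x0E; exact/esym/wtrace_twist/hcode_wpath.
split=> [alpha' aa'|].
  have [beta' ab'] := twist_hcode_ex alpha'.
  by exists beta'; [apply: twist_hprefix aa' | apply/RP].
split=> [_ l alpha' aa'|].
  have [beta' ab'] := twist_hcode_ex alpha'.
  by exists beta'; [apply: twist_subsumed aa' | apply/RP].
split=> [_ l alpha' aa'|].
  have [beta' ab'] := twist_hcode_ex alpha'.
  by exists beta'; [apply: twist_subsumed aa' | apply/RP].
split=> // _ alpha' aa'.
have [beta' ab'] := twist_hcode_ex alpha'.
by exists beta'; [apply: twist_hprefix aa' | apply/RP].
Qed.

Lemma bisimilar_twist : bisimilar all_but_similar (H true) (H false).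
Proof.
exists (fun alpha beta => hcode beta = twist (hcode alpha)).
split; apply: simulates_twist => // alpha beta.
by split=> ->; rewrite twistK.
Qed.

(** * Failure of qhp-bisimilarity *)

Hypotheses (a_neq_b : a <> b) (a_neq_d : a <> d) (b_neq_d : b <> d).

(** The ST-trace without start positions and with colours for labels. Its entries can be compared by
    computation, so that the possible partners of a path can be enumerated by [runs]. *)
Fixpoint ctrace (w : word) (cs : seq coded_step) : seq (bool * option nat) :=
  if cs is (f, v) :: cs' then
    match f with
    | Up i => (true, colour v i)
    | Dn i => (false, colour w i)
    end :: ctrace v cs'
  else [::].

Lemma colour_inj w v i j : size w = 4 -> size v = 4 ->
  wlabel L w i = wlabel L v j -> colour w i = colour v j.
Proof.
move=> sw sv; rewrite !wlabel_colour // /colour.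
case: (onth (stars w) i) => [p|]; case: (onth (stars v) j) => [q|] //=.
- by case: p => [|[|[|p]]]; case: q => [|[|[|q]]] //= [] E; congruence.
- by case: p => [|[|[|p]]].
by case: q => [|[|[|q]]].
Qed.

Lemma ctrace_eq k k' r r' w v cs ds : allowed k w -> allowed k' v ->
  wpath (allowed k) w cs -> wpath (allowed k') v ds ->
  wtrace L r w cs = wtrace L r' v ds -> ctrace w cs = ctrace v ds.
Proof.
elim: cs r r' w v ds => [|[f w'] cs IH] r r' w v [|[g v'] ds] //= wk vk.
case/and3P=> wk' _ csP /and3P[vk' _ dsP] [E T]; congr (_ :: _); last exact: IH T.
have [sw sv] := (size_allowed wk, size_allowed vk).
have [sw' sv'] := (size_allowed wk', size_allowed vk').
by case: f g E {T} => i [] j // [E] *; congr pair; apply: colour_inj E.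
Qed.

Definition edge (up : bool) (w v : word) (i : nat) : bool :=
  if up then wface false i v == Some w else wface true i w == Some v.

Definition nexts k (w : word) (e : bool * option nat) : seq word :=
  [seq v <- words4 | allowed k v &
     has (fun i => edge e.1 w v i && (colour (if e.1 then v else w) i == e.2)) (iota 0 4)].

Fixpoint runs k (w : word) (tr : seq (bool * option nat)) : seq (seq word) :=
  if tr is e :: tr' then [seq v :: s | v <- nexts k w e, s <- runs k v tr']
  else [:: [::]].

Lemma edge_bound up w v i : size w = 4 -> size v = 4 -> edge up w v i -> i \in iota 0 4.
Proof.
move=> sw sv; rewrite mem_iota /= add0n; case: (ltnP i 4) => // i4.
by rewrite /edge !wface_ge ?sw ?sv //; case: up.
Qed.

Lemma mem_nexts k w v up i : allowed k w -> allowed k v -> edge up w v i ->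
  v \in nexts k w (up, colour (if up then v else w) i).
Proof.
move=> /size_allowed sw vk wv; have sv := size_allowed vk.
rewrite mem_filter vk mem_words4 // andbT andTb; apply/hasP; exists i.
  exact: edge_bound wv.
by rewrite wv eqxx.
Qed.

Lemma mem_runs k w cs : allowed k w -> wpath (allowed k) w cs ->
  map snd cs \in runs k w (ctrace w cs).
Proof.
elim: cs w => [|[f v] cs IH] w wk; first by [].
case/and3P=> vk wv csP; apply/allpairsPdep; exists v, (map snd cs).
split=> //; last exact: IH.
by case: f wv => i wv; [apply: (@mem_nexts k w v true) | apply: (@mem_nexts k w v false)].
Qed.

Lemma allowed_origin k : allowed k origin.
Proof. by case: k. Qed.

Lemma allowed_last k w cs : allowed k w -> wpath (allowed k) w cs ->
  allowed k (last w (map snd cs)).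
Proof. by elim: cs w => [|[f v] cs IH] w //= wk /and3P[vk _]; apply: IH. Qed.

(** A necessary condition, decided by computation, for a subsumption around the cell between [v] and
    [y]. *)
Definition between k (v y : word) : bool :=
  has (fun x => has (edge true v x) (iota 0 4) && has (edge false x y) (iota 0 4))
    [seq x <- words4 | allowed k x].

(** The coded path omits the initial cell. With [origin] prepended, index [l.-1] is the cell before
    the replaced one; without it, index [l] is the cell after it. *)
Lemma subsumed_between k l (alpha beta : hpath (H k)) : subsumed l alpha beta ->
  between k (nth [::] (origin :: map snd (hcode alpha)) l.-1)
            (nth [::] (map snd (hcode alpha)) l).
Proof.
case=> i0 [j0 [_ ab]].
have [i [j [i' [j' {ab}]]]] : exists i j i' j',
    replaced l (Up i) (Dn j) (Dn j') (Up i') beta alpha.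
  by case: ab => ?; do 4 eexists; eassumption.
move=> /replaced_hcode[s [x [x' [y [t [<- bE aE]]]]]].
have := hcode_wpath beta; have := hcode_wpath alpha.
rewrite aE bE !wpath_cat => /andP[sP _] /andP[_ /= /and3P[xk vx /and3P[yk xy _]]].
rewrite map_cat -cat_cons !nth_cat /= size_map ltnSn ltnNge leqnSn /= subSnn /=.
rewrite -[X in nth _ _ X](size_map snd) -last_nth.
apply/hasP; exists x; first by rewrite mem_filter xk mem_words4 ?(size_allowed xk).
have sv := size_allowed (allowed_last (allowed_origin k) sP).
have [sx sy] := (size_allowed xk, size_allowed yk).
by apply/andP; split; apply/hasP;
  [exists i; first exact: (@edge_bound true _ _ _ sv sx vx)
  |exists j; first exact: (@edge_bound false _ _ _ sx sy xy)].
Qed.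

(** Only an inner cell is replaced. This carries the choice of the [d] over to the path with the two
    ends swapped. *)
Lemma similar_last k l (alpha beta : hpath (H k)) : similar l alpha beta ->
  last origin (map snd (hcode alpha)) = last origin (map snd (hcode beta)).
Proof.
have swp (u v : hpath (H k)) : swapped l u v ->
    last origin (map snd (hcode u)) = last origin (map snd (hcode v)).
  case=> i [j [_ uv]].
  by case: uv => /replaced_hcode[s [x [x' [y [t [_ -> ->]]]]]]; rewrite !map_cat !last_cat.
by case=> /swp.
Qed.

Lemma runs_ST k k' (alpha : hpath (H k)) (beta : hpath (H k')) cs :
  hcode alpha = cs -> ST alpha = ST beta ->
  map snd (hcode beta) \in runs k' origin (ctrace origin cs).
Proof.
move=> <-; rewrite !ST_hcode !x0E => E.
rewrite (ctrace_eq (allowed_origin k) (allowed_origin k') (hcode_wpath _) (hcode_wpath _) E).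
exact: mem_runs (allowed_origin k') (hcode_wpath beta).
Qed.

Lemma not_qhp_bisimilar : ~ bisimilar qhp (H true) (H false).
Proof.
case=> R [[R0 Rsim] _].
pose O := Some false; pose I := Some true; pose S : option bool := None.
pose v1 := [:: S; O; O; O]; pose v2 := [:: S; S; O; O]; pose vb := [:: I; S; O; O].
pose va := [:: S; I; O; O]; pose v4 := [:: I; I; O; O].
pose v5 := [:: I; I; S; O]; pose v5' := [:: I; I; O; S].
pose pre := [:: (Up 0, v1); (Up 1, v2)].
pose tl := [:: (Dn 0, v4); (Up 0, v5)].
(* On [alpha], [a] ends, then [b], then the first [d] starts; [alpha1] starts this [d] before [b]
   ends. On [alpha2] and [alpha3] it is [b] that ends first, and [alpha3] starts [d] before [a]
   ends. *)
have [alpha aE] : exists alpha : hpath (H true), hcode alpha = pre ++ (Dn 0, vb) :: tl.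
  by apply: hcode_ex; vm_compute.
have [alpha1 aE1] : exists alpha : hpath (H true),
    hcode alpha = pre ++ [:: (Dn 0, vb); (Up 1, [:: I; S; S; O]); (Dn 0, v5)].
  by apply: hcode_ex; vm_compute.
have [alpha2 aE2] : exists alpha : hpath (H true), hcode alpha = pre ++ (Dn 1, va) :: tl.
  by apply: hcode_ex; vm_compute.
have [alpha3 aE3] : exists alpha : hpath (H true),
    hcode alpha = pre ++ [:: (Dn 1, va); (Up 1, [:: S; I; S; O]); (Dn 0, v5)].
  by apply: hcode_ex; vm_compute.
have sub1 : subsumed 4 alpha alpha1.
  exists 0, 1; split=> //; right; apply/replaced_hcode; rewrite aE aE1.
  by exists (rcons pre (Dn 0, vb)), [:: I; S; S; O], v4, v5, [::].
have sim2 : similar 3 alpha2 alpha.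
  left; exists 0, 1; split=> //; right; apply/replaced_hcode; rewrite aE aE2.
  by exists pre, va, vb, v4, [:: (Up 0, v5)].
have sub3 : subsumed 4 alpha2 alpha3.
  exists 0, 1; split=> //; right; apply/replaced_hcode; rewrite aE2 aE3.
  by exists (rcons pre (Dn 1, va)), [:: S; I; S; O], v4, v5, [::].
have [beta _ ab] : exists2 beta, hprefix (hpath0 (H false)) beta & R alpha beta.
  by have [_ [ext _]] := Rsim _ _ R0; apply: ext; exists (psteps alpha).
have [STab [_ [sub [_ [sim _]]]]] := Rsim _ _ ab.
(* The trace leaves two candidates, one for each [d]; the subsumption by [alpha1] excludes the
   second [d], because [1*0*] is not a cell. *)
have bE : map snd (hcode beta) = [:: v1; v2; vb; v4; v5].
  have [beta1 /subsumed_between + _] := sub isT _ _ sub1.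
  have := runs_ST aE STab.
  rewrite [runs _ _ _](_ : _ = [:: [:: v1; v2; vb; v4; v5]; [:: v1; v2; vb; v4; v5']]).
    by rewrite !inE => /orP[/eqP|/eqP ->].
  by vm_compute.
have [beta2 /similar_last b2l ab2] := sim isT _ _ sim2.
have [STab2 [_ [sub2 _]]] := Rsim _ _ ab2.
have [beta3 /subsumed_between + _] := sub2 isT _ _ sub3.
have := runs_ST aE2 STab2; move: b2l; rewrite bE.
(* The candidate ending in [v5'] has the wrong last cell. For the one ending in [v5], starting [d]
   before the end of [a] would need [*1*0], which is absent when [k] is [false]. *)
rewrite [runs _ _ _](_ : _ = [:: [:: v1; v2; va; v4; v5]; [:: v1; v2; va; v4; v5']]).
  by rewrite !inE => + /orP[]/eqP E; rewrite E; vm_compute.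
by vm_compute.
Qed.
End Counterexample.

(** * Comparison of the bisimilarities *)

Lemma bisimilar_sub (J J' : bisim_symbol -> bool) Sigma (Y Z : HDA Sigma) :
  (forall s, J' s -> J s) -> bisimilar J Y Z -> bisimilar J' Y Z.
Proof.
move=> JJ' [R [RYZ RZY]]; exists R.
have sub Y' Z' (Q : hpath Y' -> hpath Z' -> Prop) : simulates J Q -> simulates J' Q.
  case=> Q0 Qsim; split=> // alpha beta /Qsim[? [? [h1 [h2 [h3 h4]]]]].
  by do !split=> //; move=> /JJ'; [apply: h1|apply: h2|apply: h3|apply: h4].
by split; apply: sub.
Qed.

Theorem theorem5p8 (Sigma : Type) (a b c d : Sigma)
  (hdist : a <> b /\ a <> c /\ a <> d /\ b <> c /\ b <> d /\ c <> d) :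
  (forall Y Z : HDA Sigma, bisimilar qhp Y Z -> bisimilar shp Y Z) /\
  (exists Y Z : HDA Sigma, bisimilar shp Y Z /\ ~ bisimilar qhp Y Z) /\
  (exists Y Z : HDA Sigma, bisimilar all_but_similar Y Z /\ ~ bisimilar qhp Y Z).
Proof.
have [ab [_ [ad [_ [bd _]]]]] := hdist.
have [x0 x0E] : exists x0 : forall k, cell (complex [:: a; b; d; d] (@allowed_below k)),
    forall k, cword (x0 k) = origin.
  have ex k := @cword_surj _ [:: a; b; d; d] _ (@size_allowed k)
    (@allowed_below k) _ (allowed_origin k).
  have [[xt xtE] [xf xfE]] := (ex true, ex false).
  (* A case distinction on the two values of [k] replaces a choice principle. *)
  by exists (fun k => match k with true => xt | false => xf end); case.
have YZ := bisimilar_twist x0E; have nYZ := not_qhp_bisimilar (x0E := x0E) ab ad bd.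
split; first by move=> Y Z; apply: bisimilar_sub; case.
split; exists (complex_hda (x0_dim x0E true)), (complex_hda (x0_dim x0E false)); split=> //.
by apply: bisimilar_sub YZ; case.
Qed.
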